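(* Fix $p\in\{1,\dots,k\}$. Let $\varphi(\beta)=\mathrm{ins}_p\big((a,b)^{\otimes d_p}\otimes\tilde\beta\big)$ (with $0\ne(a,b)\in W_p^*$) and all $\Gamma_j=\mathrm{ins}_p\big((e_j^p)^{\otimes d_p}\otimes\tilde\Gamma_j\big)$, $j\ne p$, decompose in grouped $p$-slots, or let the involved factorization structure be the Veronese factorization structure (with $\varphi(\beta)=(a,b)^{\otimes m}$). Then, for $A_{pq}$, $q=1,\ldots,d_p$, a part of a solution of the corresponding extremality equation (E), we have $$A_{pq}(x_{pq})=\frac{(a+bx_{pq})^{m+1}}{\prod_{j\in O_p}\langle(1,x_{pq}),e_j^p\rangle^{d_j}}\int\!\!\int\Upsilon_{pq}(x_{pq})\frac{\prod_{j\in O_p}\langle(1,x_{pq}),e_j^p\rangle^{d_j-1}}{(a+bx_{pq})^{m+3}}\,dx_{pq}\,dx_{pq},\qquad q=1,\ldots,d_p,$$ where $\Upsilon_{pq}$ is a polynomial of degree at most $L_p$. In the Veronese case the same formula applies not only for $\varphi(\beta)=(a,b)^{\otimes m}$ but also for $\varphi(\beta)=t(a,b)^{\otimes m}$, $t\in\mathbb R\setminus\{0\}$.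
   Context: Segre–Veronese factorization structure. Let $m=d_1+\cdots+d_k$, $m\ge2$, $d_j\ge1$, $W_1,\dots,W_k$ 2-dimensional real vector spaces, $V^*=\bigotimes_{i=1}^k(W_i^* )^{\otimes d_i}$ with slots labelled $(i,r)$; the slots $(p,1),\dots,(p,d_p)$ are the grouped $p$-slots. $\mathrm{ins}_j$ denotes the linear map reordering tensor factors so that the first $d_j$ factors are put in the grouped $j$-slots (used also when some other group of slots is absent). Let $\Gamma_j\in\bigotimes_{r\ne j}(W_r^* )^{\otimes d_r}$ be non-zero tensors such that $\mathfrak h:=\sum_{j}\mathrm{ins}_j(S^{d_j}W_j^*\otimes\langle\Gamma_j\rangle)\subset V^*$ has dimension $m+1$; $\varphi:\mathfrak h\hookrightarrow V^*$ is the inclusion. For $k=1$ (Veronese) $\mathfrak h=S^mW^*$, $\Gamma_1=1$, $p=1$, $d_1=m$, $O_p=\emptyset$. Notation. Identify $W_i,W_i^*$ with $\mathbb R^2$, $\langle(u,v),(a,b)\rangle=ua+vb$. With real variables $x_{ir}$: $\mathbf x=\bigotimes_{i,r}(1,x_{ir})$, $\hat{\mathbf x}_i=\bigotimes_{j\ne i}\bigotimes_s(1,x_{js})$, $\langle\mu,\alpha\rangle=\langle\mathbf x,\varphi(\alpha)\rangle$ for $\alpha\in\mathfrak h$, $\Delta_{ir}=\prod_{s\ne r}(x_{ir}-x_{is})$ ($=1$ if $d_i=1$). Fix $0\ne\beta\in\mathfrak h$. A solution of the extremality equation is a family of smooth non-vanishing functions $A_{ir}$ of one variable on open intervals $I_{ir}$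 (with $\Delta_{ir},\langle\hat{\mathbf x}_i,\Gamma_i\rangle,\langle\mu,\beta\rangle$ non-vanishing on $\prod I_{ir}$) such that for some $\alpha\in\mathfrak h$ $$\text{(E)}\quad\sum_{i=1}^k\sum_{r=1}^{d_i}\frac{\langle\mu,\beta\rangle^{m+3}}{\Delta_{ir}\langle\hat{\mathbf x}_i,\Gamma_i\rangle\prod_{b=1}^k\langle\hat{\mathbf x}_b,\Gamma_b\rangle^{d_b}}\partial_{x_{ir}}^2\Big(\frac{A_{ir}(x_{ir})}{\langle\mu,\beta\rangle^{m+1}}\prod_{j=1}^k\langle\hat{\mathbf x}_j,\Gamma_j\rangle^{d_j}\Big)=\langle\mu,\alpha\rangle .$$ $O_p\subset\{1,\dots,k\}\setminus\{p\}$ is the set of $j$ with $e_j^p\notin\langle(1,0)\rangle$, i.e. $\deg_{x}\langle(1,x),e_j^p\rangle=1$. For $j\notin O_p\cup\{p\}$ the vector $e_j^p$ spans $\langle(1,0)\rangle$. $L_p$: multiply (E) by $\Delta_{pq}\prod_{j\ne p}\langle(1,x_{pq}),e_j^p\rangle$ (an empty product is 1); the coefficients at $A_{ir},A_{ir}',A_{ir}''$, $(i,r)\ne(p,q)$, and the right-hand side become polynomials in $x_{pq}$, and $L_p$ is their highest $x_{pq}$-degree (for general $\alpha\in\mathfrak h$); it does not depend on $q$. $\int\!\int F\,dx\,dx$ denotes some second antiderivative of $F$ (determined up to adding an affine function of $x$). *)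

(* Defs.v *)
From HB Require Import structures.
From mathcomp Require Import all_boot all_order all_fingroup all_algebra.
From mathcomp Require Import all_classical all_reals all_analysis.

Set Implicit Arguments.
Unset Strict Implicit.
Unset Printing Implicit Defensive.

Import Order.TTheory GRing.Theory Num.Theory.
Import numFieldNormedType.Exports.

Local Open Scope classical_set_scope.
Local Open Scope ring_scope.

(* The spaces W_i and W_i^* are identified with R^2, written as row vectors. *)
Definition vec (R : realType) (u v : R) : 'rV[R]_2 :=
  \row_(i < 2) (if i == ord0 then u else v).

Definition pair2 (R : realType) (w e : 'rV[R]_2) : R :=
  \sum_(i < 2) w 0 i * e 0 i.

(* The tensor product of one copy of R^2 for each element of the finite type S,
   by coordinates in the standard basis; R^o makes it an R-vector space. *)
Definition tensor (R : realType) (S : finType) :=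
  {ffun {ffun S -> 'I_2} -> R^o}.

Definition pure (R : realType) (S : finType) (w : S -> 'rV[R]_2) :
  tensor R S := [ffun c : {ffun S -> 'I_2} => \prod_s w s 0 (c s)].

Definition tpow (R : realType) (S : finType) (w : 'rV[R]_2) : tensor R S :=
  pure (fun _ : S => w).

Definition pairing (R : realType) (S : finType) (X T : tensor R S) : R :=
  \sum_c X c * T c.

(* The slots (i, r) with 1 <= r <= d_i (numbered from 0). A group i of slots
   is absent exactly when d_i = 0. *)
Definition slot (k : nat) (d : 'I_k -> nat) : finType := {i : 'I_k & 'I_(d i)}.

Definition mkslot (k : nat) (d : 'I_k -> nat) (i : 'I_k) (r : 'I_(d i)) :
  slot d := Tagged (fun i => 'I_(d i)) r.

Definition omit (k : nat) (d : 'I_k -> nat) (j : 'I_k) : 'I_k -> nat :=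
  fun i => if i == j then 0%N else d i.

Lemma omit_le (k : nat) (d : 'I_k -> nat) (j i : 'I_k) : (omit d j i <= d i)%N.
Proof. by rewrite /omit; case: eqP. Qed.

Definition keep (k : nat) (d : 'I_k -> nat) (j : 'I_k) (s : slot (omit d j)) :
  slot d := mkslot (widen_ord (omit_le d j (tag s)) (tagged s)).

(* ins j v u is ins_j (u (x) v): the factors of u go to the grouped j-slots,
   those of v to all the other slots. *)
Definition ins (R : realType) (k : nat) (d : 'I_k -> nat) (j : 'I_k)
    (v : tensor R (slot (omit d j))) (u : tensor R 'I_(d j)) :
    tensor R (slot d) :=
  [ffun c : {ffun slot d -> 'I_2} =>
     u [ffun r => c (mkslot r)] * v [ffun s => c (keep s)]].

Fact ins_is_linear (R : realType) (k : nat) (d : 'I_k -> nat) (j : 'I_k)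
  (v : tensor R (slot (omit d j))) : linear (ins v).
Proof.
move=> a u u'; apply/ffunP => c; rewrite !ffunE.
by rewrite /GRing.scale /= mulrDl mulrA.
Qed.

HB.instance Definition _ (R : realType) (k : nat) (d : 'I_k -> nat) (j : 'I_k)
    (v : tensor R (slot (omit d j))) :=
  GRing.isLinear.Build R (tensor R 'I_(d j)) (tensor R (slot d)) _ (ins v)
    (@ins_is_linear R k d j v).

Definition permute (R : realType) (n : nat) (s : {perm 'I_n})
    (u : tensor R 'I_n) : tensor R 'I_n :=
  [ffun c : {ffun 'I_n -> 'I_2} => u [ffun r => c (s r)]].

Fact permute_is_linear (R : realType) (n : nat) (s : {perm 'I_n}) :
  linear (@permute R n s).
Proof. by move=> a u u'; apply/ffunP => c; rewrite !ffunE. Qed.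

HB.instance Definition _ (R : realType) (n : nat) (s : {perm 'I_n}) :=
  GRing.isLinear.Build R (tensor R 'I_n) (tensor R 'I_n) _ (@permute R n s)
    (@permute_is_linear R n s).

Definition symtensor (R : realType) (n : nat) : {vspace tensor R 'I_n} :=
  (\bigcap_(s : {perm 'I_n}) fixedSpace (linfun (@permute R n s)))%VS.

(* The space h = \sum_j ins_j (S^{d_j} W_j^* (x) <Gamma_j>); its inclusion phi
   into V^* is left implicit. *)
Definition fact_space (R : realType) (k : nat) (d : 'I_k -> nat)
    (Gamma : forall j, tensor R (slot (omit d j))) :
    {vspace tensor R (slot d)} :=
  (\sum_(j < k) (linfun (ins (Gamma j)) @: symtensor R (d j)))%VS.

Definition total_deg (k : nat) (d : 'I_k -> nat) : nat := (\sum_(i < k) d i)%N.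

(* For k = 1 the tensor Gamma_1 is a scalar, normalised to 1. *)
Definition segre_veronese (R : realType) (k : nat) (d : 'I_k -> nat)
    (Gamma : forall j, tensor R (slot (omit d j))) : Prop :=
  [/\ forall i, (1 <= d i)%N,
      (2 <= total_deg d)%N,
      forall j, Gamma j != 0,
      \dim (fact_space Gamma) = (total_deg d).+1 &
      k = 1%N -> forall j, Gamma j = [ffun=> 1] ].

Definition muT (R : realType) (k : nat) (d : 'I_k -> nat)
    (T : tensor R (slot d)) (x : slot d -> R) : R :=
  pairing (pure (fun s => vec 1 (x s))) T.

Definition gam (R : realType) (k : nat) (d : 'I_k -> nat)
    (Gamma : forall j, tensor R (slot (omit d j))) (j : 'I_k)
    (x : slot d -> R) : R :=
  pairing (pure (fun s : slot (omit d j) => vec 1 (x (keep s)))) (Gamma j).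

Definition Delta (R : realType) (k : nat) (d : 'I_k -> nat) (s : slot d)
    (x : slot d -> R) : R :=
  \prod_(r < d (tag s) | r != tagged s) (x s - x (mkslot r)).

Definition upd (R : realType) (k : nat) (d : 'I_k -> nat) (x : slot d -> R)
    (s : slot d) (t : R) : slot d -> R :=
  fun s' => if s' == s then t else x s'.

Definition partial (R : realType) (k : nat) (d : 'I_k -> nat) (n : nat)
    (s : slot d) (F : (slot d -> R) -> R) (x : slot d -> R) : R :=
  derive1n n (fun t : R => F (upd x s t)) (x s).

(* <mu,beta>^{m+3} / (Delta_ir <xhat_i,Gamma_i> \prod_b <xhat_b,Gamma_b>^{d_b}) *)
Definition prefactor (R : realType) (k : nat) (d : 'I_k -> nat)
    (Gamma : forall j, tensor R (slot (omit d j))) (beta : tensor R (slot d))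
    (s : slot d) (x : slot d -> R) : R :=
  muT beta x ^+ (total_deg d + 3)%N /
    (Delta s x * gam Gamma (tag s) x * \prod_b gam Gamma b x ^+ d b).

Definition regular_point (R : realType) (k : nat) (d : 'I_k -> nat)
    (Gamma : forall j, tensor R (slot (omit d j))) (beta : tensor R (slot d))
    (x : slot d -> R) : Prop :=
  [/\ forall s : slot d, Delta s x != 0,
      forall i, gam Gamma i x != 0 &
      muT beta x != 0].

Definition extremality_eq (R : realType) (k : nat) (d : 'I_k -> nat)
    (Gamma : forall j, tensor R (slot (omit d j)))
    (beta alpha : tensor R (slot d)) (A : slot d -> R -> R)
    (x : slot d -> R) : Prop :=
  \sum_(s : slot d) prefactor Gamma beta s x *
    partial 2 s (fun y => A s (y s) / muT beta y ^+ (total_deg d).+1 *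
                          \prod_j gam Gamma j y ^+ d j) x
  = muT alpha x.

Definition smooth_on (R : realType) (I : set R) (f : R -> R) : Prop :=
  forall (n : nat) (t : R), I t -> derivable (derive1n n f) t 1.

Definition extremal_solution (R : realType) (k : nat) (d : 'I_k -> nat)
    (Gamma : forall j, tensor R (slot (omit d j))) (beta : tensor R (slot d))
    (I : slot d -> set R) (A : slot d -> R -> R) : Prop :=
  [/\ forall s, [/\ open (I s), is_interval (I s) & I s !=set0],
      forall s, smooth_on (I s) (A s) /\ (forall t, I s t -> A s t != 0),
      forall x, (forall s, I s (x s)) -> regular_point Gamma beta x &
      exists2 alpha, alpha \in fact_space Gamma &
        forall x, (forall s, I s (x s)) ->
          extremality_eq Gamma beta alpha A x].

Definition Oset (R : realType) (k : nat) (p : 'I_k) (e : 'I_k -> 'rV[R]_2) :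
    {pred 'I_k} :=
  [pred j | (j != p) && (e j \notin <[vec 1 0]>%VS)].

(* Coefficient at the l-th derivative of A_s (l <= 2) in the left-hand side of
   the extremality equation, from the Leibniz rule
   (A G)'' = \sum_l 'C(2, l) G^(2-l) A^(l). *)
Definition coef_ext (R : realType) (k : nat) (d : 'I_k -> nat)
    (Gamma : forall j, tensor R (slot (omit d j))) (beta : tensor R (slot d))
    (s : slot d) (l : nat) (x : slot d -> R) : R :=
  prefactor Gamma beta s x * 'C(2, l)%:R *
    partial (2 - l) s (fun y => (muT beta y ^+ (total_deg d).+1)^-1 *
                                \prod_j gam Gamma j y ^+ d j) x.

(* Delta_pq \prod_(j <> p) <(1, x_pq), e_j^p>, where s = (p, q). *)
Definition clearing (R : realType) (k : nat) (d : 'I_k -> nat)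
    (e : 'I_k -> 'rV[R]_2) (s : slot d) (x : slot d -> R) : R :=
  Delta s x * \prod_(j < k | j != tag s) pair2 (vec 1 (x s)) (e j).

(* f is polynomial of degree <= D in the variable x_s, the other variables
   being fixed; the values at points where a denominator vanishes are
   irrelevant. *)
Definition polynomial_in (R : realType) (k : nat) (d : 'I_k -> nat)
    (Gamma : forall j, tensor R (slot (omit d j))) (beta : tensor R (slot d))
    (s : slot d) (D : nat) (f : (slot d -> R) -> R) : Prop :=
  forall x, regular_point Gamma beta x ->
    exists2 P : {poly R}, (size P <= D.+1)%N &
      forall t, regular_point Gamma beta (upd x s t) ->
        f (upd x s t) = P.[t].

Definition degree_bound (R : realType) (k : nat) (d : 'I_k -> nat)
    (Gamma : forall j, tensor R (slot (omit d j))) (beta : tensor R (slot d))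
    (e : 'I_k -> 'rV[R]_2) (s : slot d) (D : nat) : Prop :=
  (forall (s' : slot d) (l : nat), s' != s -> (l <= 2)%N ->
     polynomial_in Gamma beta s D
       (fun x => clearing e s x * coef_ext Gamma beta s' l x)) /\
  (forall alpha, alpha \in fact_space Gamma ->
     polynomial_in Gamma beta s D (fun x => clearing e s x * muT alpha x)).

(* L is the highest degree L_p, computed at s = (p, q). The degree of the
   right-hand side for general alpha is its maximum over all alpha in h, and
   likewise the degree in x_s of a coefficient is its maximum over all values
   of the other variables. *)
Definition highest_degree (R : realType) (k : nat) (d : 'I_k -> nat)
    (Gamma : forall j, tensor R (slot (omit d j))) (beta : tensor R (slot d))
    (e : 'I_k -> 'rV[R]_2) (s : slot d) (L : nat) : Prop :=
  degree_bound Gamma beta e s L /\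
  (forall D, degree_bound Gamma beta e s D -> (L <= D)%N).

Definition second_antiderivative (R : realType) (I : set R) (f F : R -> R) :
    Prop :=
  exists G : R -> R, forall t, I t ->
    is_derive t (1 : R) F (G t) /\ is_derive t (1 : R) G (f t).

Definition decomposable (R : realType) (k : nat) (d : 'I_k -> nat)
    (Gamma : forall j, tensor R (slot (omit d j))) (beta : tensor R (slot d))
    (p : 'I_k) (a b : R) (e : 'I_k -> 'rV[R]_2) : Prop :=
  (exists betat : tensor R (slot (omit d p)),
     beta = ins betat (tpow 'I_(d p) (vec a b))) /\
  (forall j, j != p ->
     exists Gammat : tensor R (slot (omit (omit d j) p)),
       Gamma j = ins Gammat (tpow 'I_(omit d j p) (e j))).

Definition veronese (R : realType) (k : nat) (d : 'I_k -> nat)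
    (beta : tensor R (slot d)) (a b : R) : Prop :=
  k = 1%N /\ exists2 t : R, t != 0 & beta = t *: tpow (slot d) (vec a b).

(* Main.v *)
(* Write t = x_pq.  Since beta and the Gamma_j decompose in the grouped p-slots,
   the factor of <mu, beta> depending on t is a + b t and that of
   <xhat_j, Gamma_j> is <(1, t), e_j>, with no dependence for j = p; the
   Veronese case is the special case k = 1.  Hence, after clearing
   denominators, the coefficients of (E) outside (p, q) are polynomial in t,
   while the (p, q)-summand is a non-zero constant times
     (a + b t)^(m+3) / prod_(O_p) <(1, t), e_j>^(d_j - 1) * F''(t),
     F = A_pq prod_(O_p) <(1, t), e_j>^(d_j) / (a + b t)^(m+1).
   Freezing the other variables in (E) shows that F'' has the required form. *)

Require Import Defs.
From mathcomp Require Import all_boot all_order all_algebra.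
From mathcomp Require Import zify ring.
From mathcomp Require Import all_classical all_reals all_analysis.

Set Implicit Arguments.
Unset Strict Implicit.
Unset Printing Implicit Defensive.

Import Order.TTheory GRing.Theory Num.Theory.
Import numFieldNormedType.Exports.

Local Open Scope classical_set_scope.
Local Open Scope ring_scope.

(** * Pairings of pure tensors: polynomiality and splitting off one factor *)

Lemma vec0 (R : realType) (u v : R) : vec u v 0 ord0 = u.
Proof. by rewrite mxE. Qed.

Lemma vec1 (R : realType) (u v : R) : vec u v 0 ord_max = v.
Proof. by rewrite mxE. Qed.

Lemma pair2E (R : realType) (x : R) (w : 'rV[R]_2) :
  pair2 (vec 1 x) w = w 0 ord0 + w 0 ord_max * x.
Proof.
rewrite /pair2 big_ord_recr big_ord1 /= !mxE /= mul1r mulrC.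
by congr (w 0 _ + _); apply: val_inj.
Qed.

(** In the coordinate expansion of the pairing, each multi-index contributes a scalar times a
    product of at most [#|S|] of the polynomials [y s], the coordinate at [ord0] being 1. *)
Lemma pairing_pure_poly (R : realType) (S : finType) (T : tensor R S)
    (y : S -> {poly R}) (hy : forall s, (size (y s) <= 2)%N) :
  exists2 P : {poly R}, (size P <= #|S|.+1)%N &
    forall t, pairing (pure (fun s => vec 1 (y s).[t])) T = P.[t].
Proof.
exists (\sum_(c : {ffun S -> 'I_2})
    (T c : R) *: \prod_s (if c s == ord0 then 1 else y s)).
- apply: (big_ind (fun P : {poly R} => (size P <= #|S|.+1)%N)).
  + by rewrite size_poly0.
  + move=> P Q hP hQ; apply: leq_trans (size_polyD _ _) _.
    by rewrite geq_max hP.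
  + move=> c _; apply: leq_trans (size_scale_leq _ _) _.
    apply: leq_trans (size_prod_leq _ _) _.
    rewrite leq_subLR addnS ltnS.
    rewrite addnn -mul2n mulnC -sum_nat_const.
    apply: (@leq_trans (\sum_(s : S) 2)); last by rewrite sum_nat_const.
    by apply: leq_sum => s _; case: ifP; rewrite ?size_poly1.
- move=> t; rewrite /pairing horner_sum; apply: eq_bigr => c _.
  rewrite hornerZ mulrC ffunE horner_prod; congr (_ * _).
  by apply: eq_bigr => s _; rewrite mxE; case: ifP; rewrite ?hornerE.
Qed.

(** The hypotheses say that [T] is [w] in slot [s0] tensored with something blind to that slot.
    Summing first over the index at [s0] gives [pair2 (v s0) w], because the remaining sum is the
    same for both values of this index. *)
Lemma pairing_pure_factor (R : realType) (S : finType) (s0 : S)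
    (w : 'rV[R]_2) (T T' : tensor R S)
    (hT : forall c : {ffun S -> 'I_2}, T c = w 0 (c s0) * T' c)
    (hT' : forall c c' : {ffun S -> 'I_2},
      (forall s, s != s0 -> c s = c' s) -> T' c = T' c') :
  exists2 B : (S -> 'rV[R]_2) -> R,
    forall v, pairing (pure v) T = pair2 (v s0) w * B v &
    forall v v', (forall s, s != s0 -> v s = v' s) -> B v = B v'.
Proof.
pose h (v : S -> 'rV[R]_2) (c : {ffun S -> 'I_2}) : R :=
  (\prod_(s | s != s0) v s 0 (c s)) * T' c.
pose upc i (c : {ffun S -> 'I_2}) : {ffun S -> 'I_2} :=
  [ffun s => if s == s0 then i else c s].
have hupc v i c : h v (upc i c) = h v c.
  congr (_ * _); last by apply: hT' => s /negPf ss0; rewrite ffunE ss0.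
  by apply: eq_bigr => s /negPf ss0; rewrite ffunE ss0.
(* The fibre over [ord0] serves as a model: by [hupc] the sum of [h v] over any fibre has the same
   value. *)
exists (fun v => \sum_(c : {ffun S -> 'I_2} | c s0 == ord0) h v c) =>
  [v|v v' vv'].
- rewrite /pairing.
  rewrite (partition_big (fun c : {ffun S -> 'I_2} => c s0) xpredT) //=.
  rewrite /pair2 big_distrl /=; apply: eq_bigr => i _.
  transitivity (v s0 0 i * w 0 i *
                \sum_(c : {ffun S -> 'I_2} | c s0 == i) h v c).
    rewrite big_distrr /=; apply: eq_bigr => c /eqP ci.
    by rewrite ffunE (bigD1 s0) //= hT ci /h; ring.
  congr (_ * _).
  rewrite (reindex_onto (upc i) (upc ord0)) /=; last first.
    move=> c /eqP ci; apply/ffunP => s; rewrite !ffunE.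
    by case: eqP => [->|].
  apply: eq_big => [c|c _]; last exact: hupc.
  rewrite ffunE eqxx eqxx /=; apply/eqP/eqP => [<-|c0].
    by rewrite ffunE eqxx.
  by apply/ffunP => s; rewrite !ffunE; case: eqP => // ->.
- apply: eq_bigr => c _; congr (_ * _); apply: eq_bigr => s ss0.
  by rewrite vv'.
Qed.

(** Group [p] is empty for [omit d p], so a kept slot always lies in another group. *)
Lemma keep_neq (k : nat) (d : 'I_k -> nat) (p : 'I_k) (q : 'I_(d p))
    (s : slot (omit d p)) : keep s != mkslot q.
Proof.
apply/eqP => /(congr1 (@tag _ _)) /= tsp; case: s tsp => i r /= ip; subst i.
by case: r => r; rewrite /omit eqxx.
Qed.

Lemma keep_inj (k : nat) (d : 'I_k -> nat) (j : 'I_k) :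
  injective (@keep k d j).
Proof.
move=> [i r] [i' r']; rewrite /keep /mkslot /= => E.
have ii' : i = i' by exact: (congr1 (@tag _ _) E).
subst i'; congr (existT _ _ _).
by have /(congr1 val)/= := eq_from_Tagged E; move/val_inj.
Qed.

(** Only the copy of [w] at the slot of [r0] is split off; the other copies of [w] in the grouped
    p-slots join [v] in the factor [B], which ignores this slot. Hence a single variable sees [w] to
    the first power. *)
Lemma pairing_ins_factor (R : realType) (k : nat) (d : 'I_k -> nat)
    (p : 'I_k) (r0 : 'I_(d p)) (w : 'rV[R]_2) (v : tensor R (slot (omit d p))) :
  exists2 B : (slot d -> 'rV[R]_2) -> R,
    forall y, pairing (pure y) (ins v (tpow 'I_(d p) w)) =
              pair2 (y (mkslot r0)) w * B y &
    forall y y', (forall s, s != mkslot r0 -> y s = y' s) -> B y = B y'.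
Proof.
apply: (@pairing_pure_factor _ _ _ _ _
  [ffun c : {ffun slot d -> 'I_2} =>
    (\prod_(r < d p | r != r0) w 0 (c (mkslot r))) * v [ffun s => c (keep s)]]).
- move=> c; rewrite !ffunE (bigD1 r0) //= !ffunE mulrA; congr (_ * _ * _).
  by apply: eq_bigr => r _; rewrite ffunE.
- move=> c c' cc'; rewrite !ffunE; congr (_ * v _).
    apply: eq_bigr => r rr0; rewrite cc' //; apply: contraNneq rr0 => E.
    by rewrite -(eq_from_Tagged E).
  by apply/ffunP => s; rewrite !ffunE cc' // keep_neq.
Qed.

(** * Dependence of the pairings on one variable *)

Lemma upd_same (R : realType) (k : nat) (d : 'I_k -> nat) (x : slot d -> R)
    (s : slot d) (t : R) : upd x s t s = t.
Proof. by rewrite /upd eqxx. Qed.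

Lemma upd_neq (R : realType) (k : nat) (d : 'I_k -> nat) (x : slot d -> R)
    (s s' : slot d) (t : R) : s' != s -> upd x s t s' = x s'.
Proof. by rewrite /upd => /negPf ->. Qed.

Lemma upd_id (R : realType) (k : nat) (d : 'I_k -> nat) (x : slot d -> R)
    (s : slot d) : upd x s (x s) = x.
Proof. by apply/funext => s'; rewrite /upd; case: eqP => [->|]. Qed.

Lemma upd_upd (R : realType) (k : nat) (d : 'I_k -> nat) (x : slot d -> R)
    (s : slot d) (t u : R) : upd (upd x s t) s u = upd x s u.
Proof. by apply/funext => s'; rewrite /upd; case: eqP. Qed.

Lemma updC (R : realType) (k : nat) (d : 'I_k -> nat) (x : slot d -> R)
    (s s' : slot d) (t u : R) : s' != s ->
  upd (upd x s t) s' u = upd (upd x s' u) s t.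
Proof.
move=> ss'; apply/funext => s''; rewrite /upd.
by case: eqP => // ->; rewrite (negPf ss').
Qed.

Lemma muT_upd_poly (R : realType) (k : nat) (d : 'I_k -> nat)
    (T : tensor R (slot d)) (x : slot d -> R) (s : slot d) :
  exists2 P : {poly R}, (size P <= #|slot d|.+1)%N &
    forall t, muT T (upd x s t) = P.[t].
Proof.
have [|P sP hP] := @pairing_pure_poly _ _ T
    (fun s' => if s' == s then 'X else (x s')%:P).
  by move=> s'; case: ifP; rewrite ?size_polyX // size_polyC; case: (_ != 0).
exists P => // t; rewrite -hP /muT; congr (pairing (pure _) T).
by apply/funext => s'; rewrite /upd; case: ifP; rewrite !hornerE.
Qed.

Lemma gam_upd_poly (R : realType) (k : nat) (d : 'I_k -> nat)
    (Gamma : forall j, tensor R (slot (omit d j))) (j : 'I_k)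
    (x : slot d -> R) (s : slot d) :
  exists P : {poly R}, forall t, gam Gamma j (upd x s t) = P.[t].
Proof.
have [|P sP hP] := @pairing_pure_poly _ _ (Gamma j)
    (fun s' => if keep s' == s then 'X else (x (keep s'))%:P).
  by move=> s'; case: ifP; rewrite ?size_polyX // size_polyC; case: (_ != 0).
exists P => t; rewrite -hP /gam; congr (pairing (pure _) _).
by apply/funext => s'; rewrite /upd; case: ifP; rewrite !hornerE.
Qed.

(** The cofactor ignores the slot (p, q), so it can be evaluated at [x] instead of the updated
    point; this separates [t] from the other variables. *)
Lemma muT_upd_factor (R : realType) (k : nat) (d : 'I_k -> nat) (p : 'I_k)
    (q : 'I_(d p)) (w : 'rV[R]_2) (v : tensor R (slot (omit d p))) :
  exists B : (slot d -> R) -> R, forall x t,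
    muT (ins v (tpow 'I_(d p) w)) (upd x (mkslot q) t) =
    pair2 (vec 1 t) w * B x.
Proof.
have [B hB hB'] := pairing_ins_factor q w v.
exists (fun x => B (fun s => vec 1 (x s))) => x t; rewrite /muT hB upd_same.
by congr (_ * _); apply: hB' => s sq; rewrite upd_neq.
Qed.

Lemma gam_upd_id (R : realType) (k : nat) (d : 'I_k -> nat) (p : 'I_k)
    (q : 'I_(d p)) (Gamma : forall j, tensor R (slot (omit d j)))
    (x : slot d -> R) (t : R) :
  gam Gamma p (upd x (mkslot q) t) = gam Gamma p x.
Proof.
rewrite /gam; congr (pairing (pure _) _); apply/funext => s.
by rewrite upd_neq // keep_neq.
Qed.

Lemma gam_upd_factor (R : realType) (k : nat) (d : 'I_k -> nat) (p j : 'I_k)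
    (q : 'I_(d p)) (Gamma : forall j, tensor R (slot (omit d j)))
    (w : 'rV[R]_2) (v : tensor R (slot (omit (omit d j) p)))
    (jp : j != p) (hG : Gamma j = ins v (tpow 'I_(omit d j p) w)) :
  exists H : (slot d -> R) -> R, forall x t,
    gam Gamma j (upd x (mkslot q) t) = pair2 (vec 1 t) w * H x.
Proof.
(* For [j != p] the numbers [omit d j p] and [d p] agree only up to a proof, so [q] is rebuilt as an
   index of the former. *)
have lt_q : (q < omit d j p)%N by rewrite /omit eq_sym (negPf jp).
have keep_q : keep (mkslot (Ordinal lt_q)) = mkslot q.
  by rewrite /keep /mkslot /=; congr (Tagged _ _); apply: val_inj.
have [B hB hB'] := pairing_ins_factor (Ordinal lt_q) w v.
exists (fun x => B (fun s => vec 1 (x (keep s)))) => x t.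
rewrite /gam hG hB keep_q upd_same; congr (_ * _); apply: hB' => s sq.
by rewrite upd_neq // -keep_q (inj_eq (@keep_inj _ _ _)).
Qed.

(** For k = 1 all slots are p-slots and no [j != p] exists, so only the decomposition of [beta]
    needs an argument. *)
Lemma veronese_decomposable (R : realType) (k : nat) (d : 'I_k -> nat)
    (Gamma : forall j, tensor R (slot (omit d j))) (beta : tensor R (slot d))
    (p : 'I_k) (a b : R) (e : 'I_k -> 'rV[R]_2) :
  veronese beta a b -> decomposable Gamma beta p a b e.
Proof.
move=> [k1 [t t0 ->]]; subst k; have p0 (j : 'I_1) : j = p by rewrite !ord1.
split; last by move=> j; rewrite (p0 j) eqxx.
(* A tensor over the empty set of slots is a scalar, and it absorbs the coefficient [t]. *)
exists [ffun=> t]; apply/ffunP => c; rewrite !ffunE mulrC; congr (_ * _).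
rewrite (eq_bigr (fun s : slot d => vec a b 0 (c (mkslot (tagged s)))));
  last by case.
rewrite -(sig_big_dep xpredT (fun i _ => true)
  (fun i (r : 'I_(d i)) => vec a b 0 (c (mkslot r)))) /=.
rewrite (big_pred1 p) => [|j]; last by rewrite (p0 j) /= eqxx.
by apply: eq_bigr => r _; rewrite ffunE.
Qed.

(** * Iterated derivatives on open sets: locality, rational functions, Leibniz rule *)

Lemma eq_derive1n (R : realType) (U : set R) (f g : R -> R) (n : nat) :
  open U -> (forall t, U t -> f t = g t) ->
  forall t, U t -> derive1n n f t = derive1n n g t.
Proof.
move=> oU fg; elim: n => [|n ih] t Ut; first exact: fg.
rewrite !derive1nS !derive1E; apply: near_eq_derive.
by apply: filterS (open_nbhs_nbhs (conj oU Ut)) => u /ih.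
Qed.

Lemma eq_derivable (R : realType) (U : set R) (f g : R -> R) (t : R) :
  open U -> U t -> (forall t, U t -> f t = g t) ->
  derivable f t 1 -> derivable g t 1.
Proof.
move=> oU Ut fg; apply: near_eq_derivable.
by apply: filterS (open_nbhs_nbhs (conj oU Ut)) => u /fg.
Qed.

Lemma derive1nZ (R : realType) (U : set R) (f : R -> R) (c : R) (n : nat) :
  open U ->
  (forall i t, (i < n)%N -> U t -> derivable (derive1n i f) t 1) ->
  forall t, U t -> derive1n n (fun u => c * f u) t = c * derive1n n f t.
Proof.
move=> oU; elim: n => [|n ih] df t Ut //.
rewrite !derive1nS !derive1E -[RHS]/(c *: _) -(deriveZ _ (df n t (leqnn _) Ut)).
apply: near_eq_derive; apply: filterS (open_nbhs_nbhs (conj oU Ut)) => u.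
by move=> /ih ->// i v /ltnW; exact: df.
Qed.

(** By the quotient rule every derivative is again a quotient of polynomials on [U], with
    denominator a power of [Q]; the induction carries this form along. *)
Lemma smooth_on_rational (R : realType) (U : set R) (f : R -> R)
    (P Q : {poly R}) : open U ->
  (forall t, U t -> Q.[t] != 0) -> (forall t, U t -> f t = P.[t] / Q.[t]) ->
  smooth_on U f.
Proof.
move=> oU Q0 fPQ n.
have df (g : R -> R) (N D : {poly R}) t : U t ->
    (forall t, U t -> D.[t] != 0) ->
    (forall t, U t -> g t = N.[t] / D.[t]) ->
    is_derive t (1 : R) g ((N^`() * D - N * D^`()).[t] / (D ^+ 2).[t]).
  move=> Ut D0 gND.
  have dD : derivable (fun u => D.[u]^-1) t (1 : R).
    by apply: derivableV; [exact: D0|exact: derivable_horner].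
  suff: is_derive t (1 : R) ((horner N) * (fun u => D.[u]^-1))
    ((N^`() * D - N * D^`()).[t] / (D ^+ 2).[t]).
    apply: near_eq_is_derive.
    by apply: filterS (open_nbhs_nbhs (conj oU Ut)) => u /gND ->.
  apply: DeriveDef; first by apply: derivableM => //; exact: derivable_horner.
  rewrite (deriveM (@derivable_horner _ N t) dD).
  rewrite (deriveV (D0 t Ut) (@derivable_horner _ D t)).
  rewrite !derive_val !hornerE /GRing.scale /=; field; exact: D0.
suff [N [D [D0 fND]]] : exists N D : {poly R}, (forall t, U t -> D.[t] != 0) /\
    forall t, U t -> derive1n n f t = N.[t] / D.[t].
  by move=> t Ut; have [] := df (derive1n n f) N D t Ut D0 fND.
elim: n => [|n [N [D [D0 fND]]]]; first by exists P, Q.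
exists (N^`() * D - N * D^`()), (D ^+ 2); split=> t Ut.
  by rewrite hornerE expf_neq0 // D0.
rewrite derive1nS derive1E.
by have := df (derive1n n f) N D t Ut D0 fND; move/@derive_val.
Qed.

Section Leibniz.
Variables (R : realType) (U : set R) (f g : R -> R).
Hypotheses (oU : open U) (sf : smooth_on U f) (sg : smooth_on U g).

Let derive1_mul t : U t -> derive1n 1 (fun u => f u * g u) t =
  f t * derive1n 1 g t + g t * derive1n 1 f t.
Proof.
move=> Ut; rewrite /derive1n /= !derive1E.
by rewrite (deriveM (@sf 0%N _ Ut) (@sg 0%N _ Ut)).
Qed.

Lemma derivable_mul n t : (n <= 1)%N -> U t ->
  derivable (derive1n n (fun u => f u * g u)) t 1.
Proof.
case: n => [|[|//]] _ Ut; first exact: derivableM (@sf 0%N _ Ut) (@sg 0%N _ Ut).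
apply: (@eq_derivable _ U (f * derive1n 1 g + g * derive1n 1 f)) => //.
  by move=> u /derive1_mul ->.
apply: derivableD; apply: derivableM.
- exact: (@sf 0%N).
- exact: (@sg 1%N).
- exact: (@sg 0%N).
- exact: (@sf 1%N).
Qed.

(** The shape of the sum is the one used in [coef_ext], so that the derivatives of [A] can be read
    off with their coefficients. *)
Lemma derive2_mul t : U t -> derive1n 2 (fun u => f u * g u) t =
  \sum_(l < 3) 'C(2, l)%:R * derive1n (2 - l) g t * derive1n l f t.
Proof.
move=> Ut; transitivity (derive1n 1 (f * derive1n 1 g + g * derive1n 1 f) t).
  by apply: (@eq_derive1n _ U _ _ 1%N oU) Ut => u /derive1_mul.
rewrite derive1n1 derive1E deriveD.
- rewrite (deriveM (@sf 0%N _ Ut) (@sg 1%N _ Ut)).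
  rewrite (deriveM (@sg 0%N _ Ut) (@sf 1%N _ Ut)).
  rewrite !big_ord_recr big_ord0 /= /derive1n /= -!derive1E /GRing.scale /=.
  by rewrite !bin0 bin1 binn; ring.
- exact: derivableM (@sf 0%N _ Ut) (@sg 1%N _ Ut).
- exact: derivableM (@sg 0%N _ Ut) (@sf 1%N _ Ut).
Qed.

End Leibniz.

Lemma sum_polynomial (R : realType) (J : finType) (P : pred J) (U : set R)
    (n : nat) (f : J -> R -> R) :
  (forall j, P j -> exists2 Q : {poly R}, (size Q <= n)%N &
     forall t, U t -> f j t = Q.[t]) ->
  exists2 Q : {poly R}, (size Q <= n)%N &
    forall t, U t -> \sum_(j | P j) f j t = Q.[t].
Proof.
move=> hf; have /choice [Q hQ] (j : J) : exists Q : {poly R},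
    P j -> (size Q <= n)%N /\ forall t, U t -> f j t = Q.[t].
  have [/hf [Q sQ fQ]|/negP nPj] := boolP (P j); first by exists Q.
  by exists 0.
exists (\sum_(j | P j) Q j) => [|t Ut].
  apply: (big_ind (fun Q : {poly R} => (size Q <= n)%N)).
  - by rewrite size_poly0.
  - by move=> u v hu hv; rewrite (leq_trans (size_polyD _ _)) // geq_max hu.
  - by move=> j /hQ [].
by rewrite horner_sum; apply: eq_bigr => j /hQ [_ ->].
Qed.

Definition linpoly (R : realType) (w : 'rV[R]_2) : {poly R} :=
  (w 0 ord0)%:P + w 0 ord_max *: 'X.

Lemma horner_linpoly (R : realType) (w : 'rV[R]_2) (t : R) :
  (linpoly w).[t] = pair2 (vec 1 t) w.
Proof. by rewrite pair2E !hornerE. Qed.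

Lemma size_linpoly (R : realType) (w : 'rV[R]_2) : (size (linpoly w) <= 2)%N.
Proof.
apply: leq_trans (size_polyD _ _) _; rewrite geq_max.
rewrite (leq_trans (size_polyC_leq1 _)) //=.
by apply: leq_trans (size_scale_leq _ _) _; rewrite size_polyX.
Qed.

Lemma open_horner_neq0 (R : realType) (P : {poly R}) :
  open [set t | P.[t] != 0].
Proof.
apply: (@open_comp _ _ (horner P) [set u | u != 0]).
  move=> t _; apply: differentiable_continuous; apply/derivable1_diffP.
  exact: derivable_horner.
exact: open_neq.
Qed.

(** * The extremality equation as a function of x_pq: separation and clearing of denominators *)

Section ExtremalityEquation.
Variables (R : realType) (k : nat) (d : 'I_k -> nat).
Variables (Gamma : forall j, tensor R (slot (omit d j))).
Variables (beta : tensor R (slot d)) (p : 'I_k) (q : 'I_(d p)).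
Variables (w : 'rV[R]_2) (e : 'I_k -> 'rV[R]_2).

Local Notation s := (mkslot q).
Local Notation m := (total_deg d).

(* [g j].[t] is the factor of <xhat_j, Gamma_j> depending on x_pq = t. *)
Definition gampoly (j : 'I_k) : {poly R} :=
  if j == p then 1 else linpoly (e j).
Local Notation g := gampoly.

(** [B] and [H] are obtained before [t] is given, so the factors containing x_pq are split off
    uniformly. For [j = p] this factor is 1, since the group p is absent from [Gamma p]. *)
Lemma factorization :
  (exists betat : tensor R (slot (omit d p)),
     beta = ins betat (tpow 'I_(d p) w)) /\
  (forall j, j != p ->
     exists Gammat : tensor R (slot (omit (omit d j) p)),
       Gamma j = ins Gammat (tpow 'I_(omit d j p) (e j))) ->
  exists B H, forall x t,
  muT beta (upd x s t) = (linpoly w).[t] * B x /\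
  forall j, gam Gamma j (upd x s t) = (g j).[t] * H j x.
Proof.
move=> [[betat hbeta] hGam].
have [B hB] := muT_upd_factor q w betat.
have /choice [H hH] (j : 'I_k) : exists Hj : (slot d -> R) -> R, forall x t,
    gam Gamma j (upd x s t) = (g j).[t] * Hj x.
  rewrite /gampoly; have [->|jp] := eqVneq j p.
    by exists (gam Gamma p) => x t; rewrite gam_upd_id !hornerE.
  have [Gt hGt] := hGam j jp; have [Hj hHj] := gam_upd_factor q jp hGt.
  by exists Hj => x t; rewrite horner_linpoly.
exists B, H => x t; split=> [|j]; last exact: hH.
by rewrite hbeta hB horner_linpoly.
Qed.

Lemma clearing_gampoly (x : slot d -> R) (t : R) :
  clearing e s (upd x s t) =
  Delta s (upd x s t) * \prod_j (g j).[t].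
Proof.
rewrite /clearing upd_same [in RHS](bigD1 p) //=.
rewrite [gampoly p]/gampoly eqxx -polyC1 hornerC mul1r.
congr (_ * _); apply: eq_bigr => j /negPf jp.
by rewrite /gampoly jp horner_linpoly.
Qed.

Lemma Delta_upd_poly (x : slot d -> R) (t : R) : Delta s (upd x s t) =
  (\prod_(r < d p | r != q) ('X - (x (mkslot r))%:P)).[t].
Proof.
rewrite /Delta /= horner_prod; apply: eq_bigr => r rq.
rewrite upd_same upd_neq ?hornerE //; apply: contraNneq rq => E.
by rewrite -(eq_from_Tagged E).
Qed.

Lemma size_prod_XsubC_le (P : pred 'I_(d p)) (x : slot d -> R) :
  (size (\prod_(r < d p | P r) ('X - (x (mkslot r))%:P))%R <= (d p).+1)%N.
Proof.
rewrite -big_filter size_prod_XsubC ltnS size_filter.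
apply: leq_trans (count_size _ _) _.
by rewrite [index_enum _]unlock -enumT size_enum_ord.
Qed.

(** Inside group p, the only factor of [Delta s'] containing [t] is, up to sign, also a factor of
    [Delta s]. In any other group [Delta s'] does not contain [t] at all. *)
Lemma Delta_upd_dvd (x : slot d -> R) (s' : slot d) :
  s' != s -> Delta s' x != 0 ->
  exists2 E : {poly R}, (size E <= (d p).+1)%N & forall t,
    Delta s (upd x s t) = E.[t] * Delta s' (upd x s t).
Proof.
case: s' => i r'; have [ip|ip] := eqVneq i p => s's D0.
- subst i; have r'q : r' != q by apply: contraNneq s's => ->.
  have updr r t : r != q -> upd x s t (mkslot r) = x (mkslot r).
    move=> rq; rewrite upd_neq //; apply: contraNneq rq => E.
    by rewrite -(eq_from_Tagged E).
  pose c := \prod_(r < d p | (r != r') && (r != q))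
    (x (mkslot r') - x (mkslot r)).
  have Dr' t : Delta (mkslot r') (upd x s t) = (x (mkslot r') - t) * c.
    rewrite /Delta /= (bigD1 q) /=; last by rewrite eq_sym.
    rewrite updr // upd_same; congr (_ * _); apply: eq_bigr => r /andP[_ rq].
    by rewrite updr.
  have c0 : c != 0.
    by move: D0; rewrite -[x](upd_id x s) Dr' mulf_eq0 negb_or => /andP[].
  (* The sign turns [x (mkslot r') - t] into the factor [t - x (mkslot r')] of [Delta s]. *)
  exists (- c^-1 *: \prod_(r < d p | (r != q) && (r != r'))
                       ('X - (x (mkslot r))%:P)).
    exact: leq_trans (size_scale_leq _ _) (size_prod_XsubC_le _ _).
  move=> t; rewrite -/(mkslot r') Dr' Delta_upd_poly (bigD1 r') //=.
  rewrite hornerM hornerXsubC hornerZ.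
  by field.
- have Di t : Delta (@mkslot _ d i r') (upd x s t) = Delta (@mkslot _ d i r') x.
    have ups r : upd x s t (@mkslot _ d i r) = x (mkslot r).
      by rewrite upd_neq //; apply: contraNneq ip => /(congr1 (@tag _ _)) /= ->.
    by rewrite /Delta /=; apply: eq_bigr => r _; rewrite !ups.
  exists ((Delta (@mkslot _ d i r') x)^-1 *:
          \prod_(r < d p | r != q) ('X - (x (mkslot r))%:P)).
    exact: leq_trans (size_scale_leq _ _) (size_prod_XsubC_le _ _).
  by move=> t; rewrite -/(@mkslot _ d i r') Di Delta_upd_poly hornerZ; field.
Qed.

(** * The weight under the second derivative, and existence of the highest degree *)

Variables (B : (slot d -> R) -> R) (H : 'I_k -> (slot d -> R) -> R).
Hypothesis hB : forall x t, muT beta (upd x s t) = (linpoly w).[t] * B x.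
Hypothesis hH : forall j x t, gam Gamma j (upd x s t) = (g j).[t] * H j x.

(** The factor multiplying [A] under the second derivative in (E), common to all slots. *)
Definition weight (y : slot d -> R) : R :=
  (muT beta y ^+ m.+1)^-1 * \prod_j gam Gamma j y ^+ d j.

Lemma regular_upd_neq0 (x : slot d -> R) (t : R) :
  regular_point Gamma beta (upd x s t) ->
  [/\ (linpoly w).[t] != 0, B x != 0,
      forall j, (g j).[t] != 0 & forall j, H j x != 0].
Proof.
move=> [_ G0 M0]; move: M0; rewrite hB mulf_eq0 negb_or => /andP[-> ->].
by split=> // j; move: (G0 j); rewrite hH mulf_eq0 negb_or => /andP[].
Qed.

Lemma smooth_weight (x : slot d -> R) (s' : slot d) (U : set R) :
  open U -> (forall t, U t -> muT beta (upd x s' t) != 0) ->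
  smooth_on U (fun t => weight (upd x s' t)).
Proof.
move=> oU U0; have [P _ hP] := muT_upd_poly beta x s'.
have /choice [Q hQ] := fun j => gam_upd_poly Gamma j x s'.
apply: (@smooth_on_rational _ U _ (\prod_j Q j ^+ d j) (P ^+ m.+1)) => // t Ut.
  by rewrite horner_exp expf_neq0 // -hP U0.
rewrite /weight mulrC hP horner_exp; congr (_ / _); rewrite horner_prod.
by apply: eq_bigr => j _; rewrite hQ horner_exp.
Qed.

Definition sep_weight (t : R) : R :=
  ((linpoly w).[t] ^+ m.+1)^-1 * \prod_j (g j).[t] ^+ d j.

Lemma weight_upd (x : slot d -> R) (t : R) : weight (upd x s t) =
  sep_weight t * ((B x ^+ m.+1)^-1 * \prod_j H j x ^+ d j).
Proof.
rewrite /weight /sep_weight hB exprMn invfM.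
under eq_bigr => j _ do rewrite hH exprMn.
by rewrite big_split /=; ring.
Qed.

(** Moving x_pq from [x s] to [t] multiplies [weight] by the ratio of the values of [sep_weight].
    This ratio is constant in the variable at [s'], so it passes through the derivative. *)
Lemma partial_weight (x : slot d -> R) (s' : slot d) (n : nat) (t : R) :
  s' != s -> regular_point Gamma beta x ->
  partial n s' weight (upd x s t) =
  sep_weight t * (sep_weight (x s))^-1 * partial n s' weight x.
Proof.
move=> s's xreg; rewrite /partial upd_neq //.
have [P _ hP] := muT_upd_poly beta x s'.
pose U := [set u | P.[u] != 0].
have Ux : U (x s') by rewrite /U /= -hP upd_id; case: xreg.
have oU : open U := @open_horner_neq0 R P.
have sU : smooth_on U (fun u => weight (upd x s' u)).
  by apply: smooth_weight => // u; rewrite hP.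
rewrite -(@derive1nZ _ U) //; last by move=> i u _; exact: sU.
congr (derive1n n _ _); apply/funext => u.
have [ls Bx gs _] : [/\ (linpoly w).[x s] != 0, B x != 0,
      forall j, (g j).[x s] != 0 & forall j, H j x != 0].
  by apply: regular_upd_neq0; rewrite upd_id.
have s0 : sep_weight (x s) != 0.
  rewrite mulf_neq0 ?invr_eq0 ?expf_neq0 //; apply/prodf_neq0 => j _.
  by rewrite expf_neq0.
rewrite updC // weight_upd.
have := weight_upd (upd x s' u) (upd x s' u s).
by rewrite upd_id upd_neq 1?eq_sym // => ->; rewrite mulrA mulfVK.
Qed.

(* A crude uniform bound; only the existence of the highest degree matters. *)
Definition degree_cap : nat := (d p + k + #|slot d| + 5)%N.

Let size_prod_gampoly (P : pred 'I_k) :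
  (size (\prod_(j < k | P j) g j)%R <= k.+1)%N.
Proof.
apply: leq_trans (size_prod_leq _ _) _.
rewrite leq_subLR addnS ltnS.
apply: (@leq_trans (\sum_(j < k | P j) 2)%N).
  apply: leq_sum => j _; rewrite /gampoly; case: ifP => _.
    by rewrite size_poly1.
  exact: size_linpoly.
rewrite sum_nat_const muln2 -addnn leq_add2l.
by rewrite -[leqRHS]card_ord max_card.
Qed.

(** The powers of the linear factor of [beta] cancel up to a square, the product of [(g j).[t] ^+ d
    j] in [sep_weight] cancels the one in the prefactor, and [clearing] absorbs the two remaining
    denominators [Delta s'] and [g (tag s')]. *)
Lemma polynomial_in_coef (s' : slot d) (l : nat) : s' != s ->
  polynomial_in Gamma beta s degree_cap
    (fun x => clearing e s x * coef_ext Gamma beta s' l x).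
Proof.
move=> s's x xreg; have D0 : Delta s' x != 0 by case: xreg.
have [E sE hE] := Delta_upd_dvd s's D0.
(* All factors free of [t] are collected here. *)
pose c : R := B x ^+ (m + 3) / (H (tag s') x * \prod_j H j x ^+ d j) *
  'C(2, l)%:R * ((sep_weight (x s))^-1 * partial (2 - l) s' weight x).
exists (c *: (linpoly w ^+ 2 * E * \prod_(j < k | j != tag s') g j)).
  apply: leq_trans (size_scale_leq _ _) _.
  apply: leq_trans (size_polyMleq _ _) _.
  have := size_polyMleq (linpoly w ^+ 2) E.
  have := size_polyMleq (linpoly w) (linpoly w).
  have := size_linpoly w; have := size_prod_gampoly (fun j => j != tag s').
  rewrite /= /degree_cap; move: sE; rewrite expr2.
  move: (size (_ * _ * E)%R) (size (_ * linpoly w)%R) (size (linpoly w)).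
  move: (size E) (size (\prod_(j < k | j != tag s') g j)%R) #|slot d|.
  lia.
move=> t treg; have [lt Bx gt Hx] := regular_upd_neq0 treg.
have D't : Delta s' (upd x s t) != 0 by case: treg.
rewrite clearing_gampoly hE /coef_ext -[in X in partial _ _ X]/weight.
rewrite partial_weight // /prefactor.
have -> : \prod_b gam Gamma b (upd x s t) ^+ d b =
    \prod_b (g b).[t] ^+ d b * \prod_b H b x ^+ d b.
  by rewrite -big_split; apply: eq_bigr => b _; rewrite hH exprMn.
rewrite hB hH (bigD1 (tag s')) //= hornerZ !hornerM horner_prod /c.
have gd0 : \prod_j (g j).[t] ^+ d j != 0.
  by apply/prodf_neq0 => j _; rewrite expf_neq0.
have Hd0 : \prod_j H j x ^+ d j != 0.
  by apply/prodf_neq0 => j _; rewrite expf_neq0.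
rewrite {1}/sep_weight exprMn.
have -> : (linpoly w).[t] ^+ (m + 3) =
    (linpoly w).[t] ^+ m.+1 * (linpoly w).[t] ^+ 2.
  by rewrite -exprD; congr (_ ^+ _); lia.
have lm0 : (linpoly w).[t] ^+ m.+1 != 0 by rewrite expf_neq0.
move: (linpoly w).[t] lt lm0 => lw lt; move: (lw ^+ m.+1) => lwm lm0.
move: (gt (tag s')) (Hx (tag s')) => gt' Hx'.
move: (sep_weight (x s))^-1 => sw.
by field; rewrite gt' Hx' D't gd0 Hd0 lm0.
Qed.

Lemma polynomial_in_muT (alpha : tensor R (slot d)) :
  polynomial_in Gamma beta s degree_cap
    (fun x => clearing e s x * muT alpha x).
Proof.
move=> x xreg; have [P sP hP] := muT_upd_poly alpha x s.
exists (\prod_(r < d p | r != q) ('X - (x (mkslot r))%:P) * \prod_j g j * P).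
  apply: leq_trans (size_polyMleq _ _) _.
  have := size_polyMleq (\prod_(r < d p | r != q) ('X - (x (mkslot r))%:P))
    (\prod_j g j).
  have := size_prod_gampoly xpredT.
  have := size_prod_XsubC_le (fun r => r != q) x.
  move: sP; rewrite /degree_cap; set D := \prod_(r < d p | _) _.
  move: (size (D * _)%R) (size D) (size (\prod_j g j)%R) (size P) #|slot d|.
  lia.
by move=> t _; rewrite clearing_gampoly -horner_prod Delta_upd_poly hP !hornerM.
Qed.

(** Since [degree_cap] is an admissible bound, there is a least one. *)
Lemma highest_degree_exists : exists L, highest_degree Gamma beta e s L.
Proof.
have ex : exists D, `[< degree_bound Gamma beta e s D >].
  exists degree_cap; apply/asboolP; split=> [s' l s's _|alpha _].
    exact: polynomial_in_coef.
  exact: polynomial_in_muT.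
case: (ex_minnP ex) => L /asboolP hL minL; exists L; split=> // D hD.
by apply: minL; apply/asboolP.
Qed.

(** * The summands of (E) for a solution, and the second derivative at the slot (p, q) *)

Variables (I : slot d -> set R) (A : slot d -> R -> R).
Hypothesis hd : forall i, (1 <= d i)%N.
Hypothesis oI : forall s', open (I s').
Hypothesis sA : forall s', smooth_on (I s') (A s').
Hypothesis reg : forall x, (forall s', I s' (x s')) ->
  regular_point Gamma beta x.

Definition ext_summand (s' : slot d) (y : slot d -> R) : R :=
  prefactor Gamma beta s' y *
  partial 2 s' (fun y => A s' (y s') / muT beta y ^+ m.+1 *
                         \prod_j gam Gamma j y ^+ d j) y.

Lemma box_upd (x : slot d -> R) (s' : slot d) (t : R) :
  (forall s', I s' (x s')) -> I s' t -> forall s'', I s'' (upd x s' t s'').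
Proof. by move=> xI It s''; rewrite /upd; case: eqP => [->|]. Qed.

Lemma ext_summand_coef (x : slot d -> R) (s' : slot d) :
  (forall s'', I s'' (x s'')) ->
  ext_summand s' x =
  \sum_(l < 3) coef_ext Gamma beta s' l x * derive1n l (A s') (x s').
Proof.
move=> xI; rewrite /ext_summand /partial.
have -> : (fun t : R => A s' (upd x s' t s') / muT beta (upd x s' t) ^+ m.+1 *
      \prod_j gam Gamma j (upd x s' t) ^+ d j) =
    (fun t => A s' t * weight (upd x s' t)).
  by apply/funext => t; rewrite upd_same mulrA.
rewrite (@derive2_mul _ (I s')) //; last first.
  apply: smooth_weight => // t It.
  by have [] := reg (box_upd xI It).
rewrite big_distrr /=; apply: eq_bigr => l _.
by rewrite /coef_ext /partial !mulrA.
Qed.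

Lemma ext_summand_polynomial (L : nat) (x : slot d -> R) (s' : slot d) :
  degree_bound Gamma beta e s L -> (forall s'', I s'' (x s'')) -> s' != s ->
  exists2 Q : {poly R}, (size Q <= L.+1)%N & forall t, I s t ->
    clearing e s (upd x s t) * ext_summand s' (upd x s t) = Q.[t].
Proof.
move=> [hL _] xI s's.
have [l _|Q sQ hQ] := @sum_polynomial R 'I_3 xpredT (I s) L.+1 (fun l t =>
    clearing e s (upd x s t) * coef_ext Gamma beta s' l (upd x s t) *
    derive1n l (A s') (x s')).
  have [P sP hP] := hL s' l s's (ltnSE (ltn_ord l)) x (reg xI).
  exists (derive1n l (A s') (x s') *: P).
    exact: leq_trans (size_scale_leq _ _) sP.
  by move=> t It; rewrite hP; [rewrite hornerZ mulrC|exact/reg/box_upd].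
exists Q => // t It; rewrite -hQ // ext_summand_coef; last exact: box_upd.
by rewrite upd_neq // big_distrr /=; apply: eq_bigr => l _; rewrite mulrA.
Qed.

(** This is [sep_weight] without the factors outside [Oset p e], which are constant in [t]; [A s]
    times it is the function F of the formula. *)
Definition own_weight (t : R) : R :=
  ((linpoly w).[t] ^+ m.+1)^-1 *
  \prod_(j in Oset p e) pair2 (vec 1 t) (e j) ^+ d j.

Lemma gampoly_Oset (j : 'I_k) (t : R) : j \in Oset p e ->
  (g j).[t] = pair2 (vec 1 t) (e j).
Proof. by move=> /andP[/negPf jp _]; rewrite /gampoly jp horner_linpoly. Qed.

(** Either [j = p] and the polynomial is 1, or [e j] is a multiple of (1, 0) and the linear
    coefficient vanishes; 0 is just a convenient evaluation point. *)
Lemma gampoly_const (j : 'I_k) (t : R) : j \notin Oset p e ->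
  (g j).[t] = (g j).[0].
Proof.
rewrite inE negb_and !negbK /gampoly; case: eqP => [_ _|_ /vlineP [c ->]] /=.
  by rewrite -polyC1 !hornerC.
by rewrite !horner_linpoly !pair2E !mxE /= !mulr0 !mul0r.
Qed.

Lemma prod_gampoly (n : 'I_k -> nat) (t : R) :
  \prod_j (g j).[t] ^+ n j =
  \prod_(j in Oset p e) pair2 (vec 1 t) (e j) ^+ n j *
  \prod_(j | j \notin Oset p e) (g j).[0] ^+ n j.
Proof.
rewrite (bigID (mem (Oset p e))) /=; congr (_ * _); apply: eq_bigr => j jO.
  by rewrite gampoly_Oset.
by rewrite gampoly_const.
Qed.

Lemma smooth_own_weight (U : set R) : open U ->
  (forall t, U t -> (linpoly w).[t] != 0) -> smooth_on U own_weight.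
Proof.
move=> oU U0; apply: (@smooth_on_rational _ U _
  (\prod_(j in Oset p e) linpoly (e j) ^+ d j) (linpoly w ^+ m.+1)) => // t Ut.
  by rewrite horner_exp expf_neq0 // U0.
rewrite /own_weight mulrC horner_exp horner_prod; congr (_ / _).
by apply: eq_bigr => j _; rewrite horner_exp horner_linpoly.
Qed.

Lemma own_summand (x : slot d -> R) : (forall s', I s' (x s')) ->
  exists2 c : R, c != 0 & forall t, I s t ->
    clearing e s (upd x s t) * ext_summand s (upd x s t) =
    c * ((linpoly w).[t] ^+ (m + 3) /
         \prod_(j in Oset p e) pair2 (vec 1 t) (e j) ^+ (d j - 1)) *
    derive1n 2 (fun u => A s u * own_weight u) t.
Proof.
move=> xI; pose K n := \prod_(j | j \notin Oset p e) (g j).[0] ^+ n j.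
have neq0 t (It : I s t) := regular_upd_neq0 (reg (box_upd xI It)).
have [_ B0 gx0 H0] := neq0 (x s) (xI s).
have K0 n : K n != 0.
  by apply/prodf_neq0 => j jO; rewrite expf_neq0 // -(gampoly_const (x s)).
have Hd0 : \prod_j H j x ^+ d j != 0.
  by apply/prodf_neq0 => j _; rewrite expf_neq0.
(* [B x ^+ 2] remains from the powers m + 3 and m + 1, [H p x] comes from the extra factor
   [gam Gamma p], and the two values of [K] are the constant parts of the weight and of the
   denominator; the product of the [H j x ^+ d j] cancels. *)
exists (B x ^+ 2 / H p x * (K d / K (fun j => d j - 1)%N)).
  by rewrite !mulf_neq0 ?invr_eq0 ?expf_neq0.
move=> t It; have [lt _ gt _] := neq0 t It.
have D0 : Delta s (upd x s t) != 0 by have [] := reg (box_upd xI It).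
have sW : smooth_on (I s) own_weight.
  by apply: smooth_own_weight => // u /neq0 [].
rewrite clearing_gampoly /ext_summand /partial upd_same.
pose c : R := (B x ^+ m.+1)^-1 * \prod_j H j x ^+ d j * K d.
have -> : (fun u : R => A s (upd (upd x s t) s u s) /
      muT beta (upd (upd x s t) s u) ^+ m.+1 *
      \prod_j gam Gamma j (upd (upd x s t) s u) ^+ d j) =
    (fun u => c * (A s u * own_weight u)).
  apply/funext => u; rewrite upd_upd upd_same -mulrA -/(weight (upd x s u)).
  rewrite weight_upd /sep_weight prod_gampoly /c /own_weight /K; ring.
rewrite (@derive1nZ _ (I s)) //; last first.
  by move=> i u i2; exact: derivable_mul.
rewrite /prefactor hB hH [g p]/gampoly eqxx -polyC1 hornerC mul1r.
have -> : \prod_b gam Gamma b (upd x s t) ^+ d b =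
    \prod_b (g b).[t] ^+ d b * \prod_b H b x ^+ d b.
  by rewrite -big_split; apply: eq_bigr => b _; rewrite hH exprMn.
(* One power of each [g b] is set aside to cancel against [clearing]; as [d b] is at least 1, the
   subtraction is not truncated. *)
have -> : \prod_b (g b).[t] ^+ d b =
    (\prod_b (g b).[t]) * (\prod_b (g b).[t] ^+ (d b - 1)).
  rewrite -big_split; apply: eq_bigr => b _ /=.
  by rewrite -exprS subn1 prednK.
rewrite (prod_gampoly (fun j => d j - 1)%N) -/(K _).
have g0 : \prod_j (g j).[t] != 0 by apply/prodf_neq0.
have O0 : \prod_(j in Oset p e) pair2 (vec 1 t) (e j) ^+ (d j - 1) != 0.
  by apply/prodf_neq0 => j jO; rewrite expf_neq0 // -gampoly_Oset.
have Bm0 : B x ^+ m.+1 != 0 by rewrite expf_neq0.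
rewrite /c exprMn; have -> : B x ^+ (m + 3) = B x ^+ m.+1 * B x ^+ 2.
  by rewrite -exprD; congr (_ ^+ _); lia.
move: (B x ^+ m.+1) Bm0 ((linpoly w).[t] ^+ (m + 3)) => Bm Bm0 lm.
move: (derive1n _ _ _) (K0 (fun j => d j - 1)%N) => F'' K10.
by field; rewrite O0 K10 Bm0 Hd0 g0 D0 !andbT; exact: H0.
Qed.

Lemma second_derivative_polynomial (L : nat) (alpha : tensor R (slot d)) :
  degree_bound Gamma beta e s L -> alpha \in fact_space Gamma ->
  (forall s', I s' !=set0) ->
  (forall x, (forall s', I s' (x s')) -> extremality_eq Gamma beta alpha A x) ->
  exists2 Upsilon : {poly R}, (size Upsilon <= L.+1)%N &
    forall t, I s t -> derive1n 2 (fun u => A s u * own_weight u) t =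
      Upsilon.[t] *
      ((\prod_(j in Oset p e) pair2 (vec 1 t) (e j) ^+ (d j - 1)) /
       (linpoly w).[t] ^+ (m + 3)).
Proof.
move=> hL halpha I0 hE.
(* Any point of the box will do: it freezes all variables except x_pq. *)
have /choice [x xI] : forall s', exists u, I s' u.
  by move=> s'; case: (I0 s') => u; exists u.
have [c c0 hc] := own_summand xI.
have [s' s's|Q sQ hQ] := @sum_polynomial R (slot d) (fun s' => s' != s)
    (I s) L.+1
    (fun s' t => clearing e s (upd x s t) * ext_summand s' (upd x s t)).
  exact: ext_summand_polynomial.
have [P sP hP] := hL.2 alpha halpha x (reg xI).
(* [P] is the cleared right-hand side and [Q] the sum of the other cleared summands, so [P - Q] is
   the cleared summand at (p, q). *)
exists (c^-1 *: (P - Q)) => [|t It].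
  apply: leq_trans (size_scale_leq _ _) _; apply: leq_trans (size_polyD _ _) _.
  by rewrite size_polyN geq_max sP.
have treg := reg (box_upd xI It).
have [lt _ gt _] := regular_upd_neq0 treg.
have O0 : \prod_(j in Oset p e) pair2 (vec 1 t) (e j) ^+ (d j - 1) != 0.
  by apply/prodf_neq0 => j jO; rewrite expf_neq0 // -gampoly_Oset.
have lm0 : (linpoly w).[t] ^+ (m + 3) != 0 by rewrite expf_neq0.
have PQ : P.[t] = clearing e s (upd x s t) * ext_summand s (upd x s t) + Q.[t].
  by rewrite -hP // -hQ // -(hE _ (box_upd xI It)) big_distrr /= (bigD1 s) //=.
rewrite hornerZ hornerD hornerN PQ addrK hc //.
by field; rewrite c0 lm0 O0.
Qed.
End ExtremalityEquation.

(** * The double antiderivative formula *)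

Theorem corollary3p2p2 (R : realType) (k : nat) (d : 'I_k -> nat)
    (Gamma : forall j : 'I_k, tensor R (slot (omit d j)))
    (beta : tensor R (slot d)) (p : 'I_k) (a b : R) (e : 'I_k -> 'rV[R]_2)
    (I : slot d -> set R) (A : slot d -> R -> R)
    (hSV : segre_veronese Gamma)
    (hbeta : beta \in fact_space Gamma) (hbeta0 : beta != 0)
    (hab : vec a b != 0)
    (hdec : decomposable Gamma beta p a b e \/ veronese beta a b)
    (hsol : extremal_solution Gamma beta I A) (q : 'I_(d p)) :
  exists2 L : nat, highest_degree Gamma beta e (mkslot q) L &
  exists2 Upsilon : {poly R}, (size Upsilon <= L.+1)%N &
  exists2 F : R -> R,
    second_antiderivative (I (mkslot q))
      (fun x => Upsilon.[x] *
         ((\prod_(j in Oset p e) pair2 (vec 1 x) (e j) ^+ (d j - 1)%N) /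
          (a + b * x) ^+ (total_deg d + 3)%N)) F &
    forall x, I (mkslot q) x ->
      A (mkslot q) x =
        (a + b * x) ^+ (total_deg d + 1)%N /
        (\prod_(j in Oset p e) pair2 (vec 1 x) (e j) ^+ d j) * F x.

Proof.
have [hd _ _ _ _] := hSV; case: hsol => hI hA reg [alpha halpha hE].
have {}hdec : decomposable Gamma beta p a b e.
  by case: hdec => //; exact: veronese_decomposable.
have [B [H hBH]] := factorization q hdec.
have hB x t := (hBH x t).1; have hH j x t := (hBH x t).2 j.
have oI s : open (I s) by case: (hI s).
have sA s : smooth_on (I s) (A s) by case: (hA s).
have I0 s : I s !=set0 by case: (hI s).
have lin t : (linpoly (vec a b)).[t] = a + b * t.
  by rewrite horner_linpoly pair2E vec0 vec1.
have [L hL] := highest_degree_exists hB hH; exists L => //.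
have [Ups sU hU] :=
  second_derivative_polynomial hB hH hd oI sA reg hL.1 halpha I0 hE.
exists Ups => //.
have /choice [x xI] : forall s, exists u, I s u.
  by move=> s; case: (I0 s) => u; exists u.
have neq0 t (It : I (mkslot q) t) :=
  regular_upd_neq0 hB hH (reg _ (box_upd xI It)).
have sW : smooth_on (I (mkslot q)) (own_weight d p (vec a b) e).
  by apply: smooth_own_weight => // u /neq0 [].
(* With this choice the formula for [A] only inverts [own_weight], which does not vanish on the
   interval; what remains is to identify the second derivative of [F]. *)
pose F t := A (mkslot q) t * own_weight d p (vec a b) e t.
have dF n t : (n <= 1)%N -> I (mkslot q) t -> derivable (derive1n n F) t 1.
  exact: derivable_mul.
exists F => [|t It].
  exists (derive1n 1 F) => t It; split; apply: DeriveDef.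
  - exact: (dF 0%N).
  - by rewrite derive1n1 derive1E.
  - exact: (dF 1%N).
  - by rewrite -derive1E -derive1nS hU // lin.
have [lt _ gt _] := neq0 t It; rewrite lin in lt.
have O0 : \prod_(j in Oset p e) pair2 (vec 1 t) (e j) ^+ d j != 0.
  by apply/prodf_neq0 => j jO; rewrite expf_neq0 // -(@gampoly_Oset _ _ p).
have lm0 : (a + b * t) ^+ (total_deg d).+1 != 0 by rewrite expf_neq0.
by rewrite /F /own_weight lin addn1; field; rewrite O0 lm0.
Qed.
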